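(* Let $n,m\ge2$ and let $\varphi$ be an endomorphism of $F_n\times F_m$, of one of the types I–VII (every endomorphism of $F_n\times F_m$ is of one of these types after possibly interchanging the two factors). The following conditions are equivalent: 1. $\varphi$ is uniformly continuous; 2. $\varphi$ is of type IV, VI or VII with uniformly continuous component functions $\phi$ and $\psi$.
   Context: $F_n$ is free on $a_1,\dots,a_n$ and $F_m$ is free on $b_1,\dots,b_m$. Maps act on the right. Each free group carries the prefix metric: $d(u,v)=2^{-|u\wedge v|}$ if $u\ne v$ and $d(u,u)=0$, where $u\wedge v$ is the longest common prefix of the reduced words $u,v$; $F_n\times F_m$ carries the metric $d((x,y),(z,w))=\max\{d(x,z),d(y,w)\}$. Uniform continuity is with respect to these metrics. Types of endomorphisms of $F_n\times F_m$ ($i\in\{1,\dots,n\}$, $j\in\{1,\dots,m\}$): (I) $(a_i,1)\mapsto(u^{p_i},v^{q_i})$, $(1,b_j)\mapsto(u^{r_j},v^{s_j})$ with $1\ne u\in F_n$, $1\ne v\in F_m$, integers $p_i,q_i,r_j,s_j$, none of the four families identically zero; (II) $(a_i,1)\mapsto(1,v^{q_i})$, $(1,b_j)\mapsto(z_j,v^{s_j})$ with $1\ne v\in F_m$, $z_j\in F_n$ not all trivial, integers $q_i$ not all zero, $s_j$ not all zero; (III) $(a_i,1)\mapsto(u^{p_i},1)$, $(1,b_j)\mapsto(u^{r_j},w_j)$ with $1\ne u\in F_n$, $w_j\in F_m$ not all trivial, integers $p_i$ not all zero, $r_j$ not all zero; (IV) $(a_i,1)\mapsto(1,1)$, $(1,b_j)\mapsto(z_j,w_j)$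 with $z_j\in F_n$ not all trivial and $w_j\in F_m$ not all trivial; component functions $\phi:F_m\to F_n$, $b_j\mapsto z_j$, and $\psi:F_m\to F_m$, $b_j\mapsto w_j$; (V) $(a_i,1)\mapsto(1,v^{q_i})$, $(1,b_j)\mapsto(1,v^{s_j})$ with $1\ne v\in F_m$, integers $q_i$ not all zero, $s_j$ not all zero; (VI) $(a_i,1)\mapsto(x_i,1)$, $(1,b_j)\mapsto(1,w_j)$ with $x_i\in F_n$, $w_j\in F_m$ arbitrary; component functions $\phi:F_n\to F_n$, $a_i\mapsto x_i$, and $\psi:F_m\to F_m$, $b_j\mapsto w_j$; (VII) $(a_i,1)\mapsto(1,y_i)$, $(1,b_j)\mapsto(z_j,1)$ with $y_i\in F_m$, $z_j\in F_n$ arbitrary; component functions $\phi:F_n\to F_m$, $a_i\mapsto y_i$, and $\psi:F_m\to F_n$, $b_j\mapsto z_j$. *)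

(* Defs.v *)
From HB Require Import structures.
From mathcomp Require Import all_boot all_order all_algebra.
From mathcomp Require Import boolp classical_sets reals.
From mathcomp Require Import topology Rstruct.

Set Implicit Arguments.
Unset Strict Implicit.
Unset Printing Implicit Defensive.

Import Order.TTheory GRing.Theory Num.Theory.

(* A letter [(i, true)] stands for the generator of index [i], and
   [(i, false)] for its inverse. *)
Section Words.
Context {I : choiceType}.
Implicit Types (a b : I * bool) (u v w : seq (I * bool)).

Definition linv a : I * bool := (a.1, ~~ a.2).

Definition reduced : pred (seq (I * bool)) := sorted (fun a b => b != linv a).

Definition consr a w :=
  if w is b :: w' then if b == linv a then w' else a :: w else [:: a].

Definition mulw u v := foldr consr v u.

Definition invw w := rev (map linv w).

Lemma linvK : involutive linv.
Proof. by case=> i b; rewrite /linv /= negbK. Qed.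

Lemma reduced_behead a w : reduced (a :: w) -> reduced w.
Proof. by case: w => //= b w /andP[]. Qed.

Lemma consr_id a w : reduced (a :: w) -> consr a w = a :: w.
Proof. by case: w => //= b w /andP[/negbTE ->]. Qed.

Lemma consr_reduced a w : reduced w -> reduced (consr a w).
Proof.
case: w => //= b w rw; case: eqP => [_|/eqP nb]; first exact: reduced_behead rw.
by rewrite /= nb.
Qed.

Lemma consrK a w : reduced w -> consr a (consr (linv a) w) = w.
Proof.
case: w => [|b w] rw /=; first by rewrite eqxx.
rewrite linvK; case: eqP rw => [->|_] rw; first exact: consr_id.
by rewrite /= eqxx.
Qed.

Lemma mulw_reduced u v : reduced v -> reduced (mulw u v).
Proof. by move=> rv; elim: u => //= a u; apply: consr_reduced. Qed.

Lemma mulw_consr a u v : reduced v -> mulw (consr a u) v = consr a (mulw u v).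
Proof.
move=> rv; case: u => //= b u; case: eqP => //= ->.
by rewrite consrK // mulw_reduced.
Qed.

Lemma mulwA u v w : reduced w -> mulw u (mulw v w) = mulw (mulw u v) w.
Proof. by move=> rw; elim: u => //= a u ->; rewrite mulw_consr. Qed.

Lemma mulw1 w : reduced w -> mulw w [::] = w.
Proof.
elim: w => //= a w IHw raw.
by rewrite IHw ?consr_id // (reduced_behead raw).
Qed.

Lemma invwK : involutive invw.
Proof. by move=> w; rewrite /invw map_rev revK mapK //; apply: linvK. Qed.

Lemma invw_reduced w : reduced w -> reduced (invw w).
Proof.
rewrite /invw /reduced rev_sorted sorted_map; apply: sub_sorted => a b /=.
by rewrite linvK; apply: contra_neq => ->.
Qed.

Lemma mulVw w : mulw (invw w) w = [::].
Proof.
elim: w => //= a w IHw.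
by rewrite /invw /= rev_cons /mulw foldr_rcons /= linvK eqxx.
Qed.

Fixpoint common_prefix u v :=
  match u, v with
  | a :: u', b :: v' => if a == b then a :: common_prefix u' v' else [::]
  | _, _ => [::]
  end.

Lemma common_prefixC u v : common_prefix u v = common_prefix v u.
Proof.
elim: u v => [|a u IHu] [|b v] //=; rewrite eq_sym.
by case: eqP => // ->; rewrite IHu.
Qed.

Lemma common_prefix_ultra u v w :
  minn (size (common_prefix u v)) (size (common_prefix v w))
    <= size (common_prefix u w).
Proof.
elim: u v w => [|a u IHu] [|b v] [|c w] //=; rewrite ?minn0 ?min0n //.
case: eqP => [->|_]; last by rewrite min0n.
by case: eqP => //= _; rewrite minnSS ltnS.
Qed.

End Words.

(* The free group on the basis [I]: reduced words, multiplied by concatenation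
   followed by free reduction. *)
Record free_group (I : choiceType) :=
  FreeGroup { word : seq (I * bool); word_reduced : reduced word }.

HB.instance Definition _ (I : choiceType) := [isSub for @word I].
HB.instance Definition _ (I : choiceType) := [Choice of free_group I by <:].

Section FreeGroup.
Context {I : choiceType}.
Implicit Types x y z : free_group I.

Definition free_one : free_group I := @FreeGroup I [::] isT.
Definition free_inv x : free_group I :=
  FreeGroup (invw_reduced (word_reduced x)).
Definition free_mul x y : free_group I :=
  FreeGroup (mulw_reduced (word x) (word_reduced y)).

Lemma free_mulA : associative free_mul.
Proof. by move=> x y z; apply: val_inj; rewrite /= mulwA ?word_reduced. Qed.

Lemma free_mul1g : left_id free_one free_mul.
Proof. by move=> x; apply: val_inj. Qed.

Lemma free_mulg1 : right_id free_one free_mul.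
Proof. by move=> x; apply: val_inj; rewrite /= mulw1 ?word_reduced. Qed.

Lemma free_mulVg : left_inverse free_one free_inv free_mul.
Proof. by move=> x; apply: val_inj; rewrite /= mulVw. Qed.

Lemma free_mulgV : right_inverse free_one free_inv free_mul.
Proof.
by move=> x; apply: val_inj; rewrite /= -{1}[word x]invwK mulVw.
Qed.

HB.instance Definition _ := isGroup.Build (free_group I)
  free_mulA free_mul1g free_mulg1 free_mulVg free_mulgV.

Definition free_gen (i : I) : free_group I := @FreeGroup I [:: (i, true)] isT.

End FreeGroup.

Section FreeLift.
Context {I : choiceType} {G : groupType}.
Local Open Scope group_scope.

(* The homomorphism [free_group I -> G] sending each generator [i] to [f i]. *)
Definition free_lift (f : I -> G) (x : free_group I) : G :=
  \prod_(a <- word x) (if a.2 then f a.1 else (f a.1)^-1).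

Lemma free_lift_gen f i : free_lift f (free_gen i) = f i.
Proof. by rewrite /free_lift /= big_seq1. Qed.

Lemma free_lift_is_multiplicative f :
  {morph free_lift f : x y / (x * y)%g}.
Proof.
pose F a := if a.2 then f a.1 else (f a.1)^-1.
have FV a : F (linv a) = (F a)^-1 by case: a => i [] //=; rewrite invgK.
have Fc a w : \prod_(c <- consr a w) F c = F a * \prod_(c <- w) F c.
  case: w => [|b w] /=; first by rewrite big_seq1 big_nil mulg1.
  case: eqP => [->|_]; last by rewrite big_cons.
  by rewrite big_cons FV mulVKg.
move=> x y; rewrite /free_lift -/F /=.
elim: (word x) => [|a w IHw] /=; first by rewrite big_nil mul1g.
by rewrite Fc IHw big_cons mulgA.
Qed.

HB.instance Definition _ (f : I -> G) :=
  isMultiplicative.Build (free_group I) G (free_lift f)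
    (free_lift_is_multiplicative f).

End FreeLift.

Section PrefixMetric.
Context {I : choiceType}.
Implicit Types x y z : free_group I.
Local Open Scope ring_scope.

Definition prefix_dist x y : Rdefinitions.R :=
  if x == y then 0 else 2 ^- size (common_prefix (word x) (word y)).

Lemma prefix_distxx x : prefix_dist x x = 0.
Proof. by rewrite /prefix_dist eqxx. Qed.

Lemma prefix_dist_ge0 x y : 0 <= prefix_dist x y.
Proof. by rewrite /prefix_dist; case: ifP => // _; rewrite invr_ge0 exprn_ge0. Qed.

Lemma prefix_dist_eq0 x y : prefix_dist x y = 0 -> x = y.
Proof.
rewrite /prefix_dist; case: eqP => // _ /eqP.
by rewrite invr_eq0 expf_eq0 pnatr_eq0 andbF.
Qed.

Lemma prefix_dist_sym x y : prefix_dist x y = prefix_dist y x.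
Proof. by rewrite /prefix_dist eq_sym common_prefixC. Qed.

Lemma prefix_dist_triangle y x z :
  prefix_dist x z <= prefix_dist x y + prefix_dist y z.
Proof.
have [->|xy] := eqVneq x y; first by rewrite prefix_distxx add0r.
have [->|yz] := eqVneq y z; first by rewrite prefix_distxx addr0.
have [->|xz] := eqVneq x z.
  by rewrite prefix_distxx addr_ge0 // prefix_dist_ge0.
have le2 k l : (k <= l)%N -> 2 ^- l <= 2 ^- k :> Rdefinitions.R.
  by move=> kl; rewrite lef_pV2 ?posrE ?exprn_gt0 // ler_eXn2l // ltr1n.
have := common_prefix_ultra (word x) (word y) (word z).
rewrite geq_min => /orP[] /le2 le_d; [apply: ler_wpDr|apply: ler_wpDl];
  rewrite ?prefix_dist_ge0 //.
- by rewrite /prefix_dist (negbTE xy) (negbTE xz).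
- by rewrite /prefix_dist (negbTE yz) (negbTE xz).
Qed.

HB.instance Definition _ := isMetric.Build Rdefinitions.R (free_group I)
  prefix_distxx prefix_dist_eq0 prefix_dist_sym prefix_dist_triangle.

End PrefixMetric.

(* The library's uniform structure on a product is the one of the maximum
   metric. *)
Lemma unif_continuous_free_prodE (I J : choiceType)
    (f : free_group I * free_group J -> free_group I * free_group J) :
  let d (x y : free_group I * free_group J) : Rdefinitions.R :=
    Num.max (prefix_dist x.1 y.1) (prefix_dist x.2 y.2) in
  unif_continuous f <->
  (forall e, 0 < e -> exists2 del, 0 < del &
     forall x y, d x y < del -> d (f x) (f y) < e)%R.
Proof.
move=> d; have dE x y e : ball x e y <-> (d x y < e)%R.
  by rewrite /d gt_max; split=> [[xy1 xy2]|/andP[]]; [apply/andP|].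
rewrite (@unif_continuousP Rdefinitions.R _ _ f); split=> uc e e0.
- have [del del0 H] := uc e e0; exists del => // x y /dE xy.
  by apply/dE; exact: (H (x, y)).
- have [del del0 H] := uc e e0; exists del => // -[x y] /= /dE xy.
  by apply/dE; exact: H.
Qed.

Section Types.
Local Open Scope group_scope.

Definition expgz (G : groupType) (x : G) (k : int) : G :=
  match k with Posz k => x ^+ k | Negz k => x ^- k.+1 end.

Context {n m : nat}.
Local Notation Fn := (free_group 'I_n).
Local Notation Fm := (free_group 'I_m).
Implicit Type phi : Fn * Fm -> Fn * Fm.

Local Notation a i := (free_gen i : Fn).
Local Notation b j := (free_gen j : Fm).
Local Notation nonzero p := (exists i, (p i : int) <> 0%R).
Local Notation nontrivial x := (exists i, x i <> 1%g).

Definition typeI phi : Prop :=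
  exists (u : Fn) (v : Fm) (p q : 'I_n -> int) (r s : 'I_m -> int),
    [/\ u <> 1 /\ v <> 1,
        [/\ nonzero p, nonzero q, nonzero r & nonzero s],
        forall i, phi (a i, 1) = (expgz u (p i), expgz v (q i)) &
        forall j, phi (1, b j) = (expgz u (r j), expgz v (s j))].

Definition typeII phi : Prop :=
  exists (v : Fm) (z : 'I_m -> Fn) (q : 'I_n -> int) (s : 'I_m -> int),
    [/\ v <> 1,
        [/\ nontrivial z, nonzero q & nonzero s],
        forall i, phi (a i, 1) = (1, expgz v (q i)) &
        forall j, phi (1, b j) = (z j, expgz v (s j))].

Definition typeIII phi : Prop :=
  exists (u : Fn) (w : 'I_m -> Fm) (p : 'I_n -> int) (r : 'I_m -> int),
    [/\ u <> 1,
        [/\ nontrivial w, nonzero p & nonzero r],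
        forall i, phi (a i, 1) = (expgz u (p i), 1) &
        forall j, phi (1, b j) = (expgz u (r j), w j)].

Definition typeIV_with phi (z : 'I_m -> Fn) (w : 'I_m -> Fm) : Prop :=
  [/\ nontrivial z, nontrivial w,
      forall i, phi (a i, 1) = (1, 1) &
      forall j, phi (1, b j) = (z j, w j)].

Definition typeIV phi : Prop := exists z w, typeIV_with phi z w.

Definition typeV phi : Prop :=
  exists (v : Fm) (q : 'I_n -> int) (s : 'I_m -> int),
    [/\ v <> 1,
        nonzero q /\ nonzero s,
        forall i, phi (a i, 1) = (1, expgz v (q i)) &
        forall j, phi (1, b j) = (1, expgz v (s j))].

Definition typeVI_with phi (x : 'I_n -> Fn) (w : 'I_m -> Fm) : Prop :=
  (forall i, phi (a i, 1) = (x i, 1)) /\ (forall j, phi (1, b j) = (1, w j)).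

Definition typeVI phi : Prop := exists x w, typeVI_with phi x w.

Definition typeVII_with phi (y : 'I_n -> Fm) (z : 'I_m -> Fn) : Prop :=
  (forall i, phi (a i, 1) = (1, y i)) /\ (forall j, phi (1, b j) = (z j, 1)).

Definition typeVII phi : Prop := exists y z, typeVII_with phi y z.

Definition typeIV_unif phi : Prop :=
  exists z w, [/\ typeIV_with phi z w,
    unif_continuous (free_lift z) & unif_continuous (free_lift w)].

Definition typeVI_unif phi : Prop :=
  exists x w, [/\ typeVI_with phi x w,
    unif_continuous (free_lift x) & unif_continuous (free_lift w)].

Definition typeVII_unif phi : Prop :=
  exists y z, [/\ typeVII_with phi y z,
    unif_continuous (free_lift y) & unif_continuous (free_lift z)].

End Types.

(* Main.v *)
Require Import Defs.
From HB Require Import structures.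
From mathcomp Require Import all_boot all_order all_algebra.
From mathcomp Require Import boolp classical_sets reals.
From mathcomp Require Import topology Rstruct.

(* A homomorphism of free groups sending the generators to powers of one
   element [u] kills the commutator [c] of two generators, while [c ^+ N] and
   [c ^+ N * g] get arbitrarily close; so if it is uniformly continuous it is
   trivial, and all exponents vanish since free groups are torsion-free. In
   types I, II, III and V, restricting [phi] to the first factor and projecting
   gives such a homomorphism with a nonzero exponent. In types IV, VI and VII,
   [phi] is assembled from its component functions by projections and pairing,
   and they are recovered from it by restricting and projecting. *)

Set Implicit Arguments.
Unset Strict Implicit.
Unset Printing Implicit Defensive.

Import Order.TTheory GRing.Theory Num.Theory.

(** Each turn round a cycle ends at the same last element. For the noncancellation relation this
    means that copies of a cyclically reduced word concatenate without cancellation. *)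
Lemma path_flatten_nseq (T : Type) (e : rel T) a w s k : cycle e (a :: w) ->
  path e (last a w) (flatten (nseq k (a :: w)) ++ s) = path e (last a w) s.
Proof.
rewrite /= rcons_path => /andP[aw la]; elim: k => //= k IHk.
by rewrite -catA cat_path la aw IHk.
Qed.

(** * Powers, universal property and torsion in free groups *)

Section FreeGroupTheory.
Context {I : choiceType}.
Implicit Types (x y : free_group I) (u v w : seq (I * bool)).
Local Open Scope group_scope.

Local Notation noncancel := (fun a b : I * bool => b != linv a).

Lemma mulw_cat u v : reduced (u ++ v) -> mulw u v = u ++ v.
Proof.
elim: u => //= a u IHu auv.
by rewrite IHu ?consr_id //; apply: reduced_behead auv.
Qed.

Lemma word_expg x k : cycle noncancel (word x) ->
  word (x ^+ k) = flatten (nseq k (word x)).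
Proof.
move=> cx; elim: k => [|k IHk]; first by rewrite expg0.
have -> : word (x ^+ k.+1) = mulw (word x) (word (x ^+ k)) by rewrite expgS.
rewrite IHk mulw_cat //.
rewrite -[_ ++ _]/(flatten (nseq k.+1 (word x))) -[flatten _]cats0.
case: (word x) cx => [_|a w cx]; first by elim: k {IHk}.
by apply/(@path_sorted _ _ (last a w)); rewrite path_flatten_nseq.
Qed.

(** [f] is a bare function, so that the lemma applies directly to coordinates of restrictions such
    as [fun s => (phi (s, 1)).1]. *)
Lemma free_lift_unique (G : groupType) (f : free_group I -> G) (g : I -> G) :
  {morph f : x y / x * y} -> (forall i, f (free_gen i) = g i) ->
  f =1 free_lift g.
Proof.
move=> fM fg; have f1 : f 1 = 1 by apply: (mulgI (f 1)); rewrite -fM !mulg1.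
case=> w rw; rewrite /free_lift /=; elim: w rw => [|a w IHw] raw.
  by rewrite big_nil -[RHS]f1; congr (f _); apply: val_inj.
have rw := reduced_behead raw.
have -> : FreeGroup raw = @FreeGroup I [:: a] isT * FreeGroup rw.
  by apply: val_inj; rewrite /= consr_id.
rewrite fM big_cons IHw; congr (_ * _).
case: a raw => i [] raw /=; rewrite -fg; first by congr (f _); apply: val_inj.
apply: (mulIg (f (free_gen i))); rewrite mulVg -fM -f1.
by congr (f _); apply: val_inj; rewrite /= eqxx.
Qed.

Lemma free_lift1 (G : groupType) x : free_lift (fun=> 1 : G) x = 1.
Proof.
by rewrite /free_lift big1 // => a _; case: ifP => // _; rewrite invg1.
Qed.

(** Induction on length. Powers of a cyclically reduced word are plain concatenations, hence
    nonempty unless the word is empty. Otherwise the first and last letters are mutually inverse,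
    and conjugation leaves a word shorter by two. *)
Lemma free_torsion_free x k : x ^+ k.+1 = 1 -> x = 1.
Proof.
have [N] := ubnP (size (word x)); elim: N x => // N IHN x ltxN xk1.
have [cx|ncx] := boolP (cycle noncancel (word x)).
  have := word_expg k.+1 cx; rewrite xk1 /= => /esym.
  by case E: (word x) => //= _; apply: val_inj.
case: x ltxN xk1 ncx => -[|a w] //= raw ltwN xk1.
rewrite rcons_path [path _ _ _]raw negbK /=.
case/lastP: w raw ltwN xk1 => [|w c] raw ltwN xk1.
  (* A single letter would be its own inverse, but inversion flips the sign. *)
  by case: (a) => i []; rewrite /linv /= => /eqP[].
rewrite last_rcons => /eqP ac.
have rw : reduced w.
  by have := reduced_behead raw; rewrite /reduced -cats1 => /cat_sorted2[].
pose y := FreeGroup rw; pose l := @FreeGroup I [:: c] isT.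
have xE : @FreeGroup I (a :: rcons w c) raw = y ^ l.
  apply: val_inj; rewrite conjgE.
  transitivity (mulw [:: linv c] (mulw w [:: c])) => //.
  by rewrite !mulw_cat -?cats1 -?ac //= ?cats1 //; apply: reduced_behead raw.
have y1 : y = 1.
  apply: (IHN); first by rewrite size_rcons in ltwN; apply: ltnW.
  by apply/(conjg_inj l); rewrite conjXg -xE xk1 conj1g.
by rewrite xE y1 conj1g.
Qed.

Lemma expgz_eq1 x (p : int) : expgz x p = 1 -> x <> 1 -> p = 0%R.
Proof.
case: p => [[|k]|k] //= xk1 x1; case: x1; first exact: free_torsion_free xk1.
by apply: (@free_torsion_free _ k); apply: invg_inj; rewrite xk1 invg1.
Qed.

Lemma commute_expgz (G : groupType) (x : G) (p q : int) :
  commute (expgz x p) (expgz x q).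
Proof.
have cXX k l : commute (x ^+ k) (x ^+ l) by apply: commuteX2.
case: p q => [k|k] [l|l] /=; try exact: cXX; try exact/commuteV/cXX.
- exact/commute_sym/commuteV/cXX.
- exact/commuteV/commute_sym/commuteV/cXX.
Qed.

Lemma common_prefix_cat u v : common_prefix u (u ++ v) = u.
Proof. by elim: u => //= a u ->; rewrite eqxx. Qed.

End FreeGroupTheory.

(** * Uniform continuity of projections, pairings and composites *)

Section UniformContinuity.

Lemma unif_continuous_comp (U V W : uniformType) (f : U -> V) (g : V -> W) :
  unif_continuous f -> unif_continuous g -> unif_continuous (g \o f).
Proof. by move=> fc gc A /gc /fc. Qed.

Context {U V W : uniformType}.

Lemma unif_continuous_fst : unif_continuous (@fst U V).
Proof.
move=> A eA; apply: filterS (prod_entP eA entourageT).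
by move=> [[x1 x2] [y1 y2]] /= [].
Qed.

Lemma unif_continuous_snd : unif_continuous (@snd U V).
Proof.
move=> A eA; apply: filterS (prod_entP entourageT eA).
by move=> [[x1 x2] [y1 y2]] /= [].
Qed.

Lemma unif_continuous_cst (v : V) : unif_continuous (fun _ : U => v).
Proof.
move=> A eA; apply: filterS entourageT => x _.
exact: entourage_refl.
Qed.

Lemma unif_continuous_id : unif_continuous (@id U).
Proof. by move=> A eA; apply: filterS eA => -[]. Qed.

Lemma unif_continuous_pair (f : U -> V) (g : U -> W) :
  unif_continuous f -> unif_continuous g ->
  unif_continuous (fun x => (f x, g x)).
Proof.
move=> fc gc A [[B C] /= [eB eC] BCA].
have efB : entourage [set xy | B (f xy.1, f xy.2)]%classic := fc _ eB.
have egC : entourage [set xy | C (g xy.1, g xy.2)]%classic := gc _ eC.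
apply: filterS (filterI efB egC) => -[x y] /= [fB gC].
(* [A] is a product entourage when its image under the exchange of the middle coordinates contains a
   rectangle such as [B] times [C]; the point of [A] is recovered from that image. *)
have [[[p1 p2] [q1 q2]] pqA /= [<- <- <- <-]] :=
  BCA ((f x, f y), (g x, g y)) (conj fB gC).
exact: pqA.
Qed.

End UniformContinuity.

(** * Uniformly continuous homomorphisms under which two generators commute *)

Section CommutingGenerators.
Context {I J : choiceType}.
Local Open Scope group_scope.

Lemma unif_continuous_commuting_gens
    (f : free_group I -> free_group J) (i0 i1 : I) :
  {morph f : x y / x * y} -> i0 != i1 -> unif_continuous f ->
  commute (f (free_gen i0)) (f (free_gen i1)) ->
  forall i, f (free_gen i) = 1.
Proof.
(* The tolerance 1 suffices: a nontrivial element shares only the empty prefix with the identity, so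
   it lies at distance exactly 1 from it. *)
move=> fM i01 /(@unif_continuousP Rdefinitions.R) /(_ 1%R ltr01) [d d0 fd] cf i.
pose W := [:: (i0, true); (i1, true); (i0, false); (i1, false)].
have cW : cycle (fun a b => b != linv a) W.
  by rewrite /= /linv /= !xpair_eqE !(eq_sym i1) (negbTE i01).
have rW : reduced W by apply/and4P; case/and5P: cW.
pose c : free_group I := FreeGroup rW.
have fE := free_lift_unique fM (fun=> erefl).
have f1 : f 1 = 1 by rewrite fE /free_lift big_nil.
have fV x : f x^-1 = (f x)^-1.
  by apply: (mulIg (f x)); rewrite mulVg -fM mulVg.
have fc : f c = 1.
  rewrite fE /free_lift !big_cons big_nil /= mulg1 !mulgA cf.
  by rewrite mulgK mulgV.
have fcN N : f (c ^+ N) = 1.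
  by elim: N => [|N IHN]; rewrite ?expg0 // expgS fM fc IHN mulg1.
(* Then [d^-1 < N.+1 <= 2 ^ N <= 2 ^ (4 * N)], where [4 * N] is the length of [c ^+ N]. *)
pose N := Num.truncn d^-1.
(* No inverse of a generator cancels against the last letter of [c ^+ N]. *)
pose g := @free_inv I (free_gen i).
have ccg : common_prefix (word (c ^+ N)) (word (c ^+ N * g)) = word (c ^+ N).
  have -> : word (c ^+ N * g) = mulw (word (c ^+ N)) [:: (i, false)] by [].
  rewrite word_expg // mulw_cat ?common_prefix_cat //.
  apply: (@path_sorted _ _ (i1, false)).
  by rewrite (path_flatten_nseq _ _ cW) /= /linv xpair_eqE andbF.
have := fd (c ^+ N, c ^+ N * g).
rewrite /ball /= fM fcN mul1g.
have -> : f g = (f (free_gen i))^-1 by rewrite -fV; congr (f _).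
have dN : (prefix_dist (c ^+ N)%g (c ^+ N * g)%g < d)%R.
  rewrite /prefix_dist; case: eqP => // _; rewrite ccg word_expg //.
  rewrite invf_plt ?posrE ?exprn_gt0 //.
  apply: lt_le_trans (truncnS_gt _) _.
  rewrite -natrX ler_nat -/N.
  apply: leq_trans (ltn_expl N (ltnSn 1)) _.
  rewrite leq_exp2l // size_flatten /shape map_nseq sumn_nseq.
  by rewrite leq_pmull.
move=> /(_ dN); rewrite /prefix_dist; case: eqP => [fi _|_].
  by apply: invg_inj; rewrite -fi invg1.
by rewrite /= expr0 invr1 ltxx.
Qed.

Lemma unif_continuous_cyclic_lift (u : free_group J) (p : I -> int) (i0 i1 : I) :
  i0 != i1 -> u <> 1 -> unif_continuous (free_lift (fun i => expgz u (p i))) ->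
  forall i, p i = 0%R.
Proof.
move=> i01 u1 uc i; apply: expgz_eq1 u1.
rewrite -(free_lift_gen (fun i => expgz u (p i))).
apply: (unif_continuous_commuting_gens _ i01 uc); first exact: gmulfM.
by rewrite !free_lift_gen; apply: commute_expgz.
Qed.

End CommutingGenerators.

(** * Homomorphisms of products in terms of four component maps *)

Section ProductHomomorphisms.
Context {I J I' J' : choiceType}.
Variable phi : {multiplicative (free_group I * free_group J)
                            -> (free_group I' * free_group J')}.
Variables (x : I -> free_group I') (y : I -> free_group J').
Variables (z : J -> free_group I') (w : J -> free_group J').
Local Open Scope group_scope.
Hypothesis phi_inl : forall i, phi (free_gen i, 1) = (x i, y i).
Hypothesis phi_inr : forall j, phi (1, free_gen j) = (z j, w j).

(** Since [(s, t) = (s, 1) * (1, t)], [phi] is determined by its restrictions to the factors, whose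
    four coordinates are homomorphisms fixed by their values on generators. *)
Lemma prod_morphE s t :
  phi (s, t) = (free_lift x s * free_lift z t, free_lift y s * free_lift w t).
Proof.
have pairM (G H : groupType) (a a' : G) (b b' : H) :
  (a, b) * (a', b') = (a * a', b * b') by [].
have -> : (s, t) = (s, 1) * (1, t) by rewrite pairM mulg1 mul1g.
have Ml s1 s2 : phi (s1 * s2, 1) = phi (s1, 1) * phi (s2, 1).
  by rewrite -gmulfM pairM mulg1.
have Mr t1 t2 : phi (1, t1 * t2) = phi (1, t1) * phi (1, t2).
  by rewrite -gmulfM pairM mulg1.
rewrite gmulfM; congr (_, _); congr (_ * _).
- apply: (@free_lift_unique _ _ (fun s => (phi (s, 1)).1)) => [s1 s2|i].
    by rewrite Ml.
  by rewrite phi_inl.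
- apply: (@free_lift_unique _ _ (fun t => (phi (1, t)).1)) => [t1 t2|j].
    by rewrite Mr.
  by rewrite phi_inr.
- apply: (@free_lift_unique _ _ (fun s => (phi (s, 1)).2)) => [s1 s2|i].
    by rewrite Ml.
  by rewrite phi_inl.
- apply: (@free_lift_unique _ _ (fun t => (phi (1, t)).2)) => [t1 t2|j].
    by rewrite Mr.
  by rewrite phi_inr.
Qed.

Lemma unif_continuous_components : unif_continuous phi ->
  [/\ unif_continuous (free_lift x), unif_continuous (free_lift y),
      unif_continuous (free_lift z) & unif_continuous (free_lift w)].
Proof.
move=> uc.
have inl_uc : unif_continuous (fun s => phi (s, 1)).
  have pc := unif_continuous_pair (@unif_continuous_id (free_group I))
    (@unif_continuous_cst _ (free_group J) 1).
  exact: (unif_continuous_comp pc uc).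
have inr_uc : unif_continuous (fun t => phi (1, t)).
  have pc := unif_continuous_pair (@unif_continuous_cst _ (free_group I) 1)
    (@unif_continuous_id (free_group J)).
  exact: (unif_continuous_comp pc uc).
have E1 (K : choiceType) (G : groupType) (f : K -> G) : free_lift f 1 = 1.
  by rewrite /free_lift big_nil.
have -> : free_lift x = fst \o (fun s => phi (s, 1)).
  by apply/funext => s /=; rewrite prod_morphE /= E1 mulg1.
have -> : free_lift y = snd \o (fun s => phi (s, 1)).
  by apply/funext => s /=; rewrite prod_morphE /= E1 mulg1.
have -> : free_lift z = fst \o (fun t => phi (1, t)).
  by apply/funext => t /=; rewrite prod_morphE /= E1 mul1g.
have -> : free_lift w = snd \o (fun t => phi (1, t)).
  by apply/funext => t /=; rewrite prod_morphE /= E1 mul1g.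
by split; apply: unif_continuous_comp; eassumption ||
  (exact: unif_continuous_fst || exact: unif_continuous_snd).
Qed.

End ProductHomomorphisms.

Theorem proposition6p2 (n m : nat) (hn : 2 <= n) (hm : 2 <= m)
    (phi : {multiplicative (free_group 'I_n * free_group 'I_m)
                           -> (free_group 'I_n * free_group 'I_m)})
    (hphi : typeI phi \/ typeII phi \/ typeIII phi \/ typeIV phi \/
            typeV phi \/ typeVI phi \/ typeVII phi) :
  unif_continuous phi <->
  typeIV_unif phi \/ typeVI_unif phi \/ typeVII_unif phi.
Proof.
split=> [uc|].
  (* The indices 0 and 1, available as [2 <= n]. *)
  have i01 : Ordinal (ltnW hn) != Ordinal hn by [].
  have cyc0 := unif_continuous_cyclic_lift i01.
  (* Types I and III are excluded by the first coordinate, II and V by the second: there the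
     generators of the first factor go to powers of one element. *)
  case: hphi => [|[|[|[|[|[|]]]]]].
  - move=> [u [v [p [q [r [s [[u1 _] [[i p0] _ _ _] fl fr]]]]]]].
    have [xc _ _ _] := unif_continuous_components fl fr uc.
    by case: p0; apply: cyc0 u1 xc _.
  - move=> [v [z [q [s [v1 [_ [i q0] _] fl fr]]]]].
    have [_ yc _ _] := unif_continuous_components fl fr uc.
    by case: q0; apply: cyc0 v1 yc _.
  - move=> [u [w [p [r [u1 [_ [i p0] _] fl fr]]]]].
    have [xc _ _ _] := unif_continuous_components fl fr uc.
    by case: p0; apply: cyc0 u1 xc _.
  - move=> [z [w [z1 w1 fl fr]]].
    have [_ _ zc wc] := unif_continuous_components fl fr uc.
    by left; exists z, w.
  - move=> [v [q [s [v1 [[i q0] _] fl fr]]]].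
    have [_ yc _ _] := unif_continuous_components fl fr uc.
    by case: q0; apply: cyc0 v1 yc _.
  - move=> [x [w [fl fr]]].
    have [xc _ _ wc] := unif_continuous_components fl fr uc.
    by right; left; exists x, w.
  - move=> [y [z [fl fr]]].
    have [_ yc zc _] := unif_continuous_components fl fr uc.
    by right; right; exists y, z.
have fst_uc := @unif_continuous_fst (free_group 'I_n) (free_group 'I_m).
have snd_uc := @unif_continuous_snd (free_group 'I_n) (free_group 'I_m).
(* In each of these types one factor of every product in [prod_morphE] is trivial, so multiplication
   drops out and [phi] is a pairing of component functions composed with projections. *)
case=> [[z [w [[_ _ fl fr] zc wc]]]|[]].
- have -> : (phi : _ -> _) = fun st => (free_lift z st.2, free_lift w st.2).
    apply/funext => -[s t].
    by rewrite (prod_morphE fl fr) !free_lift1 !mul1g.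
  by apply: unif_continuous_pair; apply: unif_continuous_comp snd_uc _.
- move=> [x [w [[fl fr] xc wc]]].
  have -> : (phi : _ -> _) = fun st => (free_lift x st.1, free_lift w st.2).
    apply/funext => -[s t].
    by rewrite (prod_morphE fl fr) !free_lift1 mulg1 mul1g.
  by apply: unif_continuous_pair; apply: unif_continuous_comp; eassumption.
- move=> [y [z [[fl fr] yc zc]]].
  have -> : (phi : _ -> _) = fun st => (free_lift z st.2, free_lift y st.1).
    apply/funext => -[s t].
    by rewrite (prod_morphE fl fr) !free_lift1 mulg1 mul1g.
  by apply: unif_continuous_pair; apply: unif_continuous_comp; eassumption.
Qed.
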